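(* Let $G$ be a countable group (finite or infinite). Then there exists a non-empty, strongly aperiodic $G$-subshift $X\subseteq\{0,1\}^G$.
   Context: For a finite alphabet $A$ and a countable group $G$, $A^G=\{x:G\to A\}$ carries the product topology ($A$ discrete) and the left shift action $(\sigma_g(x))_h=x_{g^{-1}h}$ for $g,h\in G$. A $G$-subshift is a subset $X\subseteq A^G$ that is closed and invariant under $\sigma_g$ for every $g\in G$. For $x\in A^G$, its stabilizer is $\mathrm{stab}_\sigma(x)=\{g\in G\mid\sigma_g(x)=x\}$. A $G$-subshift $X$ is strongly aperiodic if $\mathrm{stab}_\sigma(x)=\{1_G\}$ for every $x\in X$. *)

(* Defs.v *)
From HB Require Import structures.
From mathcomp Require Import all_boot.
From mathcomp Require Import all_classical topology.

Set Implicit Arguments.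
Unset Strict Implicit.
Unset Printing Implicit Defensive.

Local Open Scope classical_set_scope.
Local Open Scope group_scope.

Section Subshifts.
Context {G : groupType}.

(* [{ptws G -> A}] is the set of all functions from G to A, with the product
   topology. *)
Definition shift {A : Type} (g : G) (x : {ptws G -> A}) : {ptws G -> A} :=
  fun h => x (g^-1 * h).

Definition shift_stab {A : Type} (x : {ptws G -> A}) : set G :=
  [set g | shift g x = x].

Context {A : discreteTopologicalType}.

Definition subshift (X : set {ptws G -> A}) : Prop :=
  closed X /\ forall g : G, shift g @` X `<=` X.

Definition strongly_aperiodic (X : set {ptws G -> A}) : Prop :=
  forall x, X x -> shift_stab x = [set 1].

End Subshifts.

(* Main.v *)
Require Import Defs.
From HB Require Import structures.
From mathcomp Require Import all_boot all_order all_algebra.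
From mathcomp Require Import lra ring zify.

(* To every s <> 1 attach a finite set T s, and let X be the set of colorings x
   such that, for all g and s <> 1, x is not the same on g T(s) and on g s T(s).
   X is a subshift, and a nontrivial s^-1 fixing x would make the two patterns
   at g = 1 coincide. If G is finite, T s = G works, with x the indicator of 1.
   If G is infinite, choose T s disjoint from s T(s), of a size growing with the
   index of s in an enumeration of G. By compactness it is enough to satisfy
   finitely many constraints, which is done by Rosenfeld's counting argument:
   adding one cell v to a region S multiplies the proportion of colorings that
   avoid the bad events inside S by at least 3/4. Indeed, a bad event through v
   determines the coloring on one half D of its window (the one containing v)
   from the rest, so by induction the proportion spoiled by it is at most
   2^-|D| (4/3)^(|D|-1) times that of S, and these losses add up to at most
   1/4. *)

Set Implicit Arguments.
Unset Strict Implicit.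
Unset Printing Implicit Defensive.

Import Order.TTheory GRing.Theory Num.Theory.

(** * Rosenfeld's counting on a finite set of cells *)

Section Avoidance.
Context (F : realFieldType) (V E : finType).
Context (supp : E -> {set V}) (bad : E -> pred {set V}) (k : E -> nat).
Local Open Scope ring_scope.

(* Colorings of V by two colors are encoded as sets; avoiding S ignores the
   events whose support leaves S, so avoiding sets are cylinders over S. *)
Definition avoiding (S : {set V}) : {set {set V}} :=
  [set x | [forall e, (supp e \subset S) ==> ~~ bad e x]].

Definition avoiding_but (S : {set V}) e : {set {set V}} :=
  [set x in avoiding S | bad e x].

Hypothesis bad_local :
  forall e x y, x :&: supp e = y :&: supp e -> bad e x = bad e y.
(* On bad colorings, the block D is determined by its complement, which costs
   a factor 2 ^ #|D| in card_avoiding_but. *)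
Hypothesis block : forall e v, v \in supp e ->
  exists D : {set V}, [/\ v \in D, #|D| = (k e).+1 &
    forall x y, bad e x -> bad e y -> x :\: D = y :\: D -> x = y].
(* 2 / 3 = (1 / 2) * (4 / 3): each cell of a block costs 1/2 and gains 4/3. *)
Hypothesis sparse : forall v : V,
  \sum_(e | v \in supp e) (2 / 3 : F) ^+ k e <= 1 / 2.

Lemma avoiding_sub (R S : {set V}) :
  R \subset S -> avoiding S \subset avoiding R.
Proof.
move=> sRS; apply/subsetP => x; rewrite !inE => /forallP gx.
apply/forallP => e; apply/implyP => sR.
exact: (implyP (gx e)) (subset_trans sR sRS).
Qed.

Lemma card_avoiding_but (S : {set V}) (D : {set V}) e :
    (forall x y, bad e x -> bad e y -> x :\: D = y :\: D -> x = y) ->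
  (#|avoiding_but S e| * 2 ^ #|D| <= #|avoiding (S :\: D)|)%N.
Proof.
move=> injD; rewrite -card_powerset -cardsX.
(* Overwriting a coloring x on D by an arbitrary Z loses no information. *)
pose f (p : {set V} * {set V}) := (p.1 :\: D) :|: p.2.
have fD p : p \in setX (avoiding_but S e) (powerset D) ->
    (f p) :\: D = p.1 :\: D /\ f p :&: D = p.2.
  case: p => x Z; rewrite !inE /= => /andP[_ /subsetP ZD].
  split; apply/setP => v; rewrite !inE; have := ZD v;
    by case: (v \in Z) (v \in D) (v \in x) => [] [] [] // /(_ isT).
rewrite -(card_in_imset (f := f)); last first.
  move=> p q pX qX fpq; have [p1 p2] := fD _ pX; have [q1 q2] := fD _ qX.
  case: p q pX qX fpq p1 p2 q1 q2 => [x Z] [y W] /= pX qX fpq p1 p2 q1 q2.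
  congr (_, _); last by rewrite -p2 -q2 fpq.
  move: pX qX; rewrite !inE => /andP[/andP[_ bx] _] /andP[/andP[_ b_y] _].
  by apply: injD => //; rewrite -p1 -q1 fpq.
apply/subset_leq_card/subsetP => _ /imsetP[p pX ->].
have [fpD _] := fD _ pX.
move: pX; rewrite !inE => /andP[/andP[/forallP gp _] _].
apply/forallP => e'; apply/implyP => sSD.
(* An event supported off [D] does not see the overwriting. *)
have -> : bad e' (f p) = bad e' p.1.
  apply: bad_local; move: sSD; rewrite subsetD => /andP[_ /setDidPl <-].
  by rewrite !setIDA -!setIDAC fpD.
by apply: (implyP (gp e')); apply: subset_trans sSD (subsetDl _ _).
Qed.

Let N S : F := #|avoiding S|%:R.

(** The cells of [S :\: R] are added one at a time. Asking for the step only when [P] is smaller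
    than [S] lets [avoiding_step] supply its own induction hypothesis. *)
Lemma avoiding_chain (R S : {set V}) :
    (forall (P : {set V}) v, (#|P| < #|S|)%N -> 3 / 4 * N P <= N (v |: P)) ->
  R \subset S -> (3 / 4) ^+ #|S :\: R| * N R <= N S.
Proof.
move=> step; move eqn: #|S :\: R| => n; elim: n R eqn => [|n IH] R eqn sRS.
  rewrite expr0 mul1r; suff -> : R = S by [].
  apply/eqP; rewrite eqEsubset sRS -setD_eq0 -cards_eq0; exact/eqP.
have [v] : exists v, v \in S :\: R by apply/set0Pn; rewrite -cards_eq0 eqn.
rewrite inE => /andP[vR vS].
have := IH (v |: R).
have -> : S :\: (v |: R) = (S :\: R) :\ v by rewrite setDDl setUC.
have := cardsD1 v (S :\: R); rewrite inE vR vS eqn add1n => -[<-].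
rewrite subUset sub1set vS sRS => /(_ erefl isT); apply: le_trans.
rewrite exprSr -mulrA ler_wpM2l ?exprn_ge0 ?divr_ge0 ?ler0n //; apply: step.
by apply: proper_card; rewrite properE sRS; apply/subsetPn; exists v.
Qed.

(** If the support of the violated event missed [v], it would lie in [S], and the coloring would not
    avoid [S]. *)
Lemma avoiding_setD (S : {set V}) v :
  avoiding S :\: avoiding (v |: S) \subset
    \bigcup_(e | v \in supp e) avoiding_but S e.
Proof.
apply/subsetP => x; rewrite inE => /andP[].
rewrite {1}inE negb_forall => /existsP[e]; rewrite negb_imply negbK.
move=> /andP[se be] gx; apply/bigcupP; exists e; last by rewrite inE gx.
apply: contraLR be => ve; move: gx; rewrite inE => /forallP/(_ e)/implyP; apply.
apply/subsetP => u ue; move: (subsetP se _ ue); rewrite !inE.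
by case/orP => // /eqP uv; rewrite uv (negPf ve) in ue.
Qed.

Lemma avoiding_step (S : {set V}) v : 3 / 4 * N S <= N (v |: S).
Proof.
have [n leSn] := ubnP #|S|; elim: n S v leSn => // n IH S v leSn.
have chain (R : {set V}) : R \subset S -> (3 / 4) ^+ #|S :\: R| * N R <= N S.
  apply: avoiding_chain => P u ltPS; apply: IH; exact: leq_trans ltPS _.
have [vS|vS] := boolP (v \in S).
  have /setUidPr -> : [set v] \subset S by rewrite sub1set.
  have : 0 <= N S by rewrite ler0n.
  lra.
have bound e : v \in supp e ->
   #|avoiding_but S e|%:R <= 1 / 2 * N S * (2 / 3) ^+ k e.
  move=> /block[D [vD cD injD]].
  have := card_avoiding_but S injD; rewrite cD -(ler_nat F) natrM natrX.
  have /chain := subsetDl S D; rewrite setDDr setDv set0U -/(N _).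
  (* [v] lies in [D] but not in [S], which saves one factor 3/4. *)
  have : (#|S :&: D| <= k e)%N.
    rewrite -ltnS -cD; apply: proper_card.
    rewrite properE subsetIr; apply/subsetPn; exists v => //.
    by rewrite inE (negPf vS).
  set B := #|avoiding_but S e|%:R; set P := N (_ :\: _); set Q := N S.
  move=> leak ch1 ch2.
  have P0 : 0 <= P by rewrite ler0n.
  have ch3 : (3 / 4) ^+ k e * P <= Q.
    apply: le_trans ch1; rewrite ler_wpM2r //.
    by apply: ler_wiXn2l leak; lra.
  have q0 : 0 < (3 / 4 : F) ^+ k e by rewrite exprn_gt0 ?divr_gt0 ?ltr0n.
  rewrite -(ler_pM2l q0) in ch2; have := le_trans ch2 ch3.
  rewrite exprS => H.
  have r0 : 0 < (2 / 3 : F) ^+ k e by rewrite exprn_gt0 ?divr_gt0 ?ltr0n.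
  move: H; rewrite -(ler_pM2r r0).
  have -> : (3 / 4) ^+ k e * (B * (2%:R * 2%:R ^+ k e)) * (2 / 3 : F) ^+ k e
     = (3 / 4 * 2%:R * (2 / 3)) ^+ k e * (2 * B) by rewrite !exprMn; ring.
  have -> : 3 / 4 * 2%:R * (2 / 3) = 1 :> F by lra.
  rewrite expr1n; lra.
have cardB : (#|avoiding S :\: avoiding (v |: S)|
    <= \sum_(e | v \in supp e) #|avoiding_but S e|)%N.
  apply: leq_trans (subset_leq_card (avoiding_setD S v)) _.
  elim/big_rec2: _ => [|e A m _ leAm]; first by rewrite cards0.
  by apply: leq_trans (leq_card_setU _ _) _; rewrite leq_add2l.
(* The factor 1/2 of [bound] times the 1/2 of [sparse]. *)
have : #|avoiding S :\: avoiding (v |: S)|%:R <= N S * (1 / 4).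
  move: cardB; rewrite -(ler_nat F) natr_sum => /le_trans; apply.
  apply: le_trans (ler_sum _ bound) _; rewrite -mulr_sumr.
  have := sparse v; have : 0 <= N S by rewrite ler0n.
  set w := \sum_(e | _) _ => N0 w2.
  have := ler_wpM2l N0 w2; lra.
have := cardsID (avoiding (v |: S)) (avoiding S).
have /setIidPr -> := avoiding_sub (subsetUr [set v] S).
move=> /(congr1 (fun n => n%:R : F)); rewrite natrD /N; lra.
Qed.

(** Nonempty supports make every coloring avoid the empty region, and each added cell keeps the
    count positive. *)
Lemma exists_avoiding : (forall e, supp e != set0) ->
  exists x, forall e, ~~ bad e x.
Proof.
move=> supp0.
have := avoiding_chain (fun P v _ => avoiding_step P v) (sub0set setT).
have -> : N set0 = #|{set V}|%:R.
  congr (_%:R); apply: eq_card => x; rewrite inE; apply/forallP => e.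
  by rewrite subset0 (negPf (supp0 e)).
move=> H; have : 0 < N setT.
  apply: lt_le_trans H; rewrite mulr_gt0 ?exprn_gt0 ?divr_gt0 ?ltr0n //.
  by apply/card_gt0P; exists set0.
rewrite ltr0n => /card_gt0P[x]; rewrite inE => /forallP gx.
by exists x => e; apply: (implyP (gx e)).
Qed.

End Avoidance.

(* Imported only here because it shadows the finset lemmas used above. *)
From mathcomp Require Import all_classical topology.

Local Open Scope classical_set_scope.

(** * Summability of the event weights *)

Section Weights.
Context (F : realFieldType).
Local Open Scope ring_scope.

(** The left side bounds the weight at one cell of all events whose shift has index [n]: blocks have
    4(n+5)+1 cells, and at most twice as many windows contain the cell. *)
Lemma weight_le (n : nat) :
  (2 / 3 : F) ^+ (4 * (n + 5)) *+ (2 * (4 * (n + 5)).+1) <= (1 / 2) ^+ n.+2.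
Proof.
(* (2/3)^4 <= 1/4, while 4j+1 <= 2^j for j = n+5. *)
have lin : ((4 * (n + 5)).+1 <= 2 ^ (n + 5))%N.
  by elim: n => // n IH; rewrite addSn expnS; lia.
rewrite -mulr_natr natrM.
have {lin} : (4 * (n + 5)).+1%:R <= 2 ^+ (n + 5) :> F by rewrite -natrX ler_nat.
set c := _%:R => lin.
have small : (2 / 3 : F) ^+ (4 * (n + 5)) <= (1 / 4) ^+ (n + 5).
  rewrite exprM lerXn2r ?nnegrE ?exprn_ge0 ?divr_ge0 ?ler0n //.
  by rewrite !exprS expr0; lra.
have c0 : 0 <= c by rewrite ler0n.
have p0 : 0 <= (2 / 3 : F) ^+ (4 * (n + 5)).
  by rewrite exprn_ge0 ?divr_ge0 ?ler0n.
have := ler_pM p0 c0 small lin.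
rewrite -exprMn; have -> : 1 / 4 * 2 = 1 / 2 :> F by lra.
have h0 : 0 <= (1 / 2 : F) ^+ n by rewrite exprn_ge0 ?divr_ge0 ?ler0n.
by rewrite exprD !exprS expr0; lra.
Qed.

Lemma geometric_half (N : nat) : \sum_(i < N) (1 / 2 : F) ^+ i.+2 <= 1 / 2.
Proof.
(* Strengthened to the closed form so that the induction goes through. *)
suff : \sum_(i < N) (1 / 2 : F) ^+ i.+2 <= 1 / 2 - (1 / 2) ^+ N.+1.
  have : 0 <= (1 / 2 : F) ^+ N.+1 by rewrite exprn_ge0 ?divr_ge0 ?ler0n.
  lra.
elim: N => [|N IH]; first by rewrite big_ord0 expr1; lra.
rewrite big_ord_recr /=; move: IH; rewrite !(exprS _ N.+1); lra.
Qed.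

(** [s'] may have repetitions, so a crude list of candidates can serve as a bound. *)
Lemma ler_sum_subset (T : eqType) (w : T -> F) (s s' : seq T) :
    (forall x, 0 <= w x) -> uniq s -> {subset s <= s'} ->
  \sum_(x <- s) w x <= \sum_(x <- s') w x.
Proof.
move=> w0; elim: s s' => [|x s IH] s' /=.
  by move=> _ _; rewrite big_nil sumr_ge0.
move=> /andP[xs us] sub; have xs' : x \in s' by apply: sub; rewrite mem_head.
rewrite (perm_big _ (perm_to_rem xs')) !big_cons lerD2l; apply: IH => // y ys.
have : y \in x :: rem x s'.
  by rewrite -(perm_mem (perm_to_rem xs')) sub // inE ys orbT.
by rewrite inE; case: eqVneq => // yx; rewrite -yx ys in xs.
Qed.

Lemma geometric_half_inj (T : eqType) (f : T -> nat) (s : seq T) :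
  injective f -> uniq s -> \sum_(x <- s) (1 / 2 : F) ^+ (f x).+2 <= 1 / 2.
Proof.
move=> injf us; pose N := (\max_(x <- s) f x).+1.
apply: le_trans (geometric_half N).
rewrite -(big_mkord xpredT (fun i => (1 / 2 : F) ^+ i.+2)).
rewrite -(big_map f xpredT (fun i => (1 / 2 : F) ^+ i.+2)).
apply: ler_sum_subset; first by move=> i; rewrite exprn_ge0 ?divr_ge0 ?ler0n.
  by rewrite map_inj_uniq.
move=> _ /mapP[x xs ->]; rewrite mem_index_iota /= ltnS.
exact: leq_bigmax_seq.
Qed.

End Weights.

(** * The subshift of distinct windows *)

Section Shift.
Context (G : groupType).
Local Open Scope group_scope.

(** [p] is the pair (s, g) of a shift and a position, so that one type indexes all constraints. *)
Definition distinguishes (T : G -> seq G) (x : G -> bool) (p : G * G) :=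
  has (fun t => x (p.2 * t) != x (p.2 * p.1 * t)) (T p.1).

Definition distinct_windows (T : G -> seq G) : set {ptws G -> bool} :=
  [set x | forall p, p.1 != 1 -> distinguishes T x p].

(** Only finitely many coordinates are read, and each has closed fibres. *)
Lemma closed_distinguishes T p :
  closed [set x : {ptws G -> bool} | distinguishes T x p].
Proof.
have coord (g : G) (b : bool) : closed [set x : {ptws G -> bool} | x g = b].
  have cont : continuous (fun x : {ptws G -> bool} => x g).
    exact: (@proj_continuous G (fun=> bool) g).
  exact: (continuous_closedP _).1 cont [set b] (discrete_closed _).
rewrite /distinguishes; elim: (T p.1) => [|t s IH] /=.
  rewrite (_ : [set x | _] = set0) //; first exact: closed0.
  by apply/seteqP; split.
rewrite (_ : [set x | _] =
  ([set x : {ptws G -> bool} | x (p.2 * t) = true] `&`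
   [set x : {ptws G -> bool} | x (p.2 * p.1 * t) = false]) `|`
  ([set x : {ptws G -> bool} | x (p.2 * t) = false] `&`
   [set x : {ptws G -> bool} | x (p.2 * p.1 * t) = true]) `|`
  [set x : {ptws G -> bool} |
     has (fun t => x (p.2 * t) != x (p.2 * p.1 * t)) s]).
  by apply: closedU => //; apply: closedU; apply: closedI; apply: coord.
apply/seteqP; split => x /=.
  case/orP => [|?]; last by right.
  by case: (x (p.2 * t)) (x (p.2 * p.1 * t)) => [] [] // _;
    left; [left | right].
by case=> [[[-> ->]|[-> ->]]//|->]; rewrite orbT.
Qed.

Lemma subshift_distinct_windows T : subshift (distinct_windows T).
Proof.
split.
  have -> : distinct_windows T = \bigcap_(p in [set p | p.1 != 1])
      [set x : {ptws G -> bool} | distinguishes T x p].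
    by apply/seteqP; split => x /= hx p; apply: hx.
  by apply: closed_bigI => p _; apply: closed_distinguishes.
move=> g _ [x hx <-] [s h] s1.
(* Shifting by [g] moves the constraint at [h] to [g^-1 * h]. *)
have /hasP[t tT xt] := hx (s, g^-1 * h) s1.
by apply/hasP; exists t => //; rewrite /shift !mulgA.
Qed.

Lemma strongly_aperiodic_distinct_windows T :
  strongly_aperiodic (distinct_windows T).
Proof.
move=> x hx; apply/seteqP; split => g /=; last first.
  by move=> ->; apply/funext => h; rewrite /shift invg1 mul1g.
move=> xg; apply/eqP; apply: contraT => g1.
have /hasP[t _] : distinguishes T x (g^-1, 1) by apply: hx; rewrite invg_eq1.
by rewrite /= !mul1g -[X in X _ != _]xg eqxx.
Qed.

Lemma distinct_windows_finite (l : seq G) :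
  (forall g, g \in l) -> distinct_windows (fun=> l) !=set0.
Proof.
move=> full; exists (fun g => g == 1) => -[s g] /= s1.
(* At t = [g^-1] the first window reads the cell 1, the second the conjugate [g * s * g^-1], which
   is not 1. *)
apply/hasP; exists g^-1; rewrite ?full //= mulgV eqxx.
rewrite divg_eq1; suff /negPf-> : g * s != g by [].
by rewrite -[X in _ != X]mulg1 (inj_eq (mulgI _)).
Qed.

(** Greedy choice: a new element has to avoid only the finite lists T, sT and s^-1 T, and [s != 1]
    separates it from its own translate. *)
Lemma exists_disjoint_translate (s : G) (n : nat) :
    (forall l : seq G, exists g, g \notin l) -> s != 1 ->
  exists T : seq G, [/\ uniq T, size T = n &
    forall t t', t \in T -> t' \in T -> t != s * t'].
Proof.
move=> inf s1; elim: n => [|n [T [uT sT dT]]]; first by exists nil.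
have [g] := inf (T ++ [seq s * t | t <- T] ++ [seq s^-1 * t | t <- T]).
rewrite !mem_cat !negb_or => /and3P[gT gsT gVT].
exists (g :: T); split => [|/=|t t']; rewrite /= ?gT ?sT //.
rewrite !inE => /orP[/eqP->|tT] /orP[/eqP->|tT'].
- by rewrite -[X in X != _]mul1g (inj_eq (mulIg _)) eq_sym.
- by apply: contraNneq gsT => ->; apply: map_f.
- by apply: contraNneq gVT => tE; apply/mapP; exists t; rewrite // tE mulKg.
- exact: dT.
Qed.

End Shift.

(** * Non-emptiness by counting and compactness *)

Section DistinctWindows.
Context (G : groupType).
Local Open Scope group_scope.
Context (T : G -> seq G) (f : G -> nat) (injf : injective f).
Let k s := (4 * (f s + 5))%N.
Hypothesis uniqT : forall s, s != 1 -> uniq (T s).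
Hypothesis sizeT : forall s, s != 1 -> size (T s) = (k s).+1.
Hypothesis disjT : forall s, s != 1 ->
  forall t t', t \in T s -> t' \in T s -> t != s * t'.

Let left_window (p : G * G) := [seq p.2 * t | t <- T p.1].
Let right_window (p : G * G) := [seq p.2 * p.1 * t | t <- T p.1].
Let window p := left_window p ++ right_window p.

(** The constraints are grouped by shift s: [weight_le] bounds each group, and injectivity of [f]
    makes the bounds terms of one geometric series. *)
Lemma window_sparse (F : realFieldType) (L : seq (G * G)) (h : G) :
    {in L, forall p, p.1 != 1} -> uniq L ->
  (\sum_(p <- L | h \in window p) (2 / 3 : F) ^+ k p.1 <= 1 / 2)%R.
Proof.
move=> L1 uL; rewrite -big_filter.
pose S := undup [seq p.1 | p <- L].
(* The positions g such that h lies in the window of (s, g). *)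
pose cand s := [seq h * t^-1 | t <- T s] ++ [seq h * t^-1 * s^-1 | t <- T s].
have w0 n : (0 <= (2 / 3 : F) ^+ n)%R by rewrite exprn_ge0 ?divr_ge0 ?ler0n.
apply: (@le_trans _ _
  (\sum_(p <- [seq (s, g) | s <- S, g <- cand s]) (2 / 3) ^+ k p.1)%R).
  apply: ler_sum_subset => //; first exact: filter_uniq.
  move=> [s g]; rewrite mem_filter => /andP[hw pL].
  apply/allpairsPdep; exists s, g; split => //.
    by rewrite mem_undup; apply/mapP; exists (s, g).
  move: hw; rewrite !mem_cat => /orP[] /mapP[t tT ->] /=.
    by apply/orP; left; apply/mapP; exists t; rewrite // mulgK.
  by apply/orP; right; apply/mapP; exists t; rewrite // !mulgK.
rewrite big_allpairs_dep /=.
apply: le_trans (geometric_half_inj F injf (undup_uniq [seq p.1 | p <- L])).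
rewrite -/S big_seq [leRHS]big_seq; apply: ler_sum => s.
rewrite mem_undup => /mapP[p pL ->].
rewrite big_const_seq count_predT iter_addr_0 size_cat !size_map sizeT ?L1 //.
by rewrite addnn -mul2n weight_le.
Qed.

Lemma exists_distinguishing_seq (L : seq (G * G)) :
    {in L, forall p, p.1 != 1} ->
  exists x : G -> bool, {in L, forall p, distinguishes T x p}.
Proof.
wlog uL : L / uniq L.
  move=> H L1; have [|x hx] := H (undup L) (undup_uniq _).
    by move=> p; rewrite mem_undup; apply: L1.
  by exists x => p pL; apply: hx; rewrite mem_undup.
move=> L1.
pose V := seq_sub (flatten [seq window p | p <- L]).
pose E := seq_sub L.
have E1 (e : E) : (val e).1 != 1 by apply: L1; apply: valP.
(* Cells outside [V] get the color [false]. *)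
pose lift (x : {set V}) g := [exists v in x, val v == g].
have liftE x (v : V) : lift x (val v) = (v \in x).
  apply/existsP/idP => [[u /andP[ux /eqP/val_inj <-]] //|vx].
  by exists v; rewrite vx eqxx.
have inV (e : E) g : g \in window (val e) -> exists v : V, val v = g.
  move=> ge; have gV : g \in flatten [seq window p | p <- L].
    by apply/flattenP; exists (window (val e)) => //; apply/map_f/valP.
  by exists (SeqSub gV).
pose supp (e : E) : {set V} := [set v : V | val v \in window (val e)]%SET.
pose bad (e : E) (x : {set V}) := ~~ distinguishes T (lift x) (val e).
have bad_eq (e : E) x t : bad e x -> t \in T (val e).1 ->
    lift x ((val e).2 * t) = lift x ((val e).2 * (val e).1 * t).
  by move=> /hasPn be tT; have /negPn/eqP := be _ tT.
have lw (e : E) t : t \in T (val e).1 -> (val e).2 * t \in window (val e).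
  by move=> tT; rewrite mem_cat; apply/orP; left; apply: map_f.
have rw (e : E) t : t \in T (val e).1 ->
    (val e).2 * (val e).1 * t \in window (val e).
  by move=> tT; rewrite mem_cat; apply/orP; right; apply: map_f.
have [||||x hx] := @exists_avoiding rat V E supp bad (fun e => k (val e).1).
- move=> e x y xy; have lxy g : g \in window (val e) -> lift x g = lift y g.
    move=> /[dup] gw /inV[v vg]; rewrite -vg !liftE.
    by move/setP: xy => /(_ v); rewrite !inE vg gw !andbT.
  congr (~~ _); apply: eq_in_has => t tT; rewrite !lxy //.
    exact: rw.
  exact: lw.
- move=> e v; rewrite inE mem_cat.
  have cardD A : uniq A -> {subset A <= window (val e)} ->
      #|[set v : V | val v \in A]%SET| = size A.
    move=> uA sA; rewrite cardE -(size_map val).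
    apply/perm_size/uniq_perm => //.
      by rewrite (map_inj_uniq val_inj) enum_uniq.
    move=> g; apply/mapP/idP => [[u]|gA]; first by rewrite mem_enum inE => ? ->.
    have [u ug] := inV _ _ (sA _ gA); exists u => //.
    by rewrite mem_enum inE ug.
  have offD (x y : {set V}) (A : seq G) g : {subset A <= window (val e)} ->
      x :\: [set v : V | val v \in A]%SET =
        y :\: [set v : V | val v \in A]%SET ->
      g \in window (val e) -> g \notin A -> lift x g = lift y g.
    move=> sA xy /inV[u <-] uA; rewrite !liftE.
    by move/setP: xy => /(_ u); rewrite !inE uA.
  have lsub : {subset left_window (val e) <= window (val e)}.
    by move=> g ga; rewrite mem_cat ga.
  have rsub : {subset right_window (val e) <= window (val e)}.
    by move=> g ga; rewrite mem_cat ga orbT.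
  have disj t t' : t \in T (val e).1 -> t' \in T (val e).1 ->
      (val e).2 * t != (val e).2 * (val e).1 * t'.
    by move=> tT tT'; rewrite -mulgA (inj_eq (mulgI _)) disjT.
  (* On a bad coloring the two halves of the window agree, so the half containing [v] can be read
     off the other, which is disjoint from it. *)
  case/orP => vA; [exists [set v : V | val v \in left_window (val e)]%SET
                 |exists [set v : V | val v \in right_window (val e)]%SET].
  + split; first by rewrite inE.
      rewrite cardD // ?size_map ?sizeT // map_inj_uniq ?uniqT //.
      exact: mulgI.
    move=> x y bx b_y xy; apply/setP => u; rewrite -!liftE.
    have off g := offD _ _ _ g lsub xy.
    have [/mapP[t tT ->]|uA] := boolP (val u \in left_window (val e)).
      rewrite !(bad_eq e) //; apply: off; first exact: rw.
      by apply/mapP => -[t' tT' /eqP]; rewrite eq_sym (negPf (disj _ _ tT' tT)).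
    move/setP: xy => /(_ u); rewrite !inE (negPf uA) !liftE; exact.
  + split; first by rewrite inE.
      rewrite cardD // ?size_map ?sizeT // map_inj_uniq ?uniqT //.
      exact: mulgI.
    move=> x y bx b_y xy; apply/setP => u; rewrite -!liftE.
    have off g := offD _ _ _ g rsub xy.
    have [/mapP[t tT ->]|uA] := boolP (val u \in right_window (val e)).
      rewrite -!(bad_eq e) //; apply: off; first exact: lw.
      by apply/mapP => -[t' tT' /eqP]; rewrite (negPf (disj _ _ tT tT')).
    move/setP: xy => /(_ u); rewrite !inE (negPf uA) !liftE; exact.
- move=> v; apply: le_trans (window_sparse rat (val v) L1 uL).
  rewrite (eq_bigl (fun e : E => val v \in window (val e))); last first.
    by move=> e; rewrite inE.
  rewrite -(big_map val (fun p => val v \in window p)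
    (fun p => (2 / 3) ^+ k p.1)%R).
  rewrite le_eqVlt (perm_big L) ?eqxx //; apply: uniq_perm => //.
    by rewrite (map_inj_uniq val_inj) index_enum_uniq.
  move=> p; apply/mapP/idP => [[e _ ->]|pL]; first exact: valP.
  by exists (SeqSub pL); rewrite ?mem_index_enum.
- move=> e; have : (0 < size (T (val e).1))%N by rewrite sizeT.
  case eqT : (T _) => [//|t s] _.
  have tT : t \in T (val e).1 by rewrite eqT mem_head.
  have [v vt] := inV e _ (lw e t tT).
  by apply/set0Pn; exists v; rewrite inE vt lw.
by exists (lift x) => p pL; have := hx (SeqSub pL); rewrite negbK.
Qed.

(** Finitely many constraints can be met together, so they generate a proper filter; by compactness
    it has a cluster point, which lies in every closed constraint set. *)
Lemma distinct_windows_neq0 : distinct_windows T !=set0.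
Proof.
have : compact [set: {ptws G -> bool}].
  have := @tychonoff G (fun=> bool) (fun=> setT) (fun=> bool_compact).
  by congr compact; apply/seteqP; split.
pose D : set (G * G) := [set p | p.1 != 1].
pose C (p : G * G) := [set x : {ptws G -> bool} | distinguishes T x p].
have finC : finI D C.
  move=> L sL.
  have [p pL|x hx] := exists_distinguishing_seq (L := finmap.enum_fset L).
    by have := sL p pL; rewrite inE.
  by exists x => p /= pL; apply: hx.
move=> cpt; have PF := finI_filter finC.
have [|x [_ clx]] := cpt _ PF; first exact: filterT.
exists x => p p1.
apply: (closed_distinguishes (p := p)) => B; apply: clx.
by exists (C p) => //; apply: finI_from1.
Qed.

End DistinctWindows.

Theorem theorem2p4 (G : groupType) (countG : countable [set: G]) :
  exists X : set {ptws G -> bool},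
    [/\ X !=set0, subshift X & strongly_aperiodic X].
Proof.
suff [T neT] : exists T : G -> seq G, distinct_windows T !=set0.
  exists (distinct_windows T); split => //.
  - exact: subshift_distinct_windows.
  - exact: strongly_aperiodic_distinct_windows.
(* [G] is finite exactly when some list exhausts it. *)
have [[l fin]|inf] := pselect (exists l : seq G, forall g, g \in l).
  by exists (fun=> l); apply: distinct_windows_finite.
have {}inf (l : seq G) : exists g, g \notin l.
  apply: contrapT => /forallNP H; apply: inf; exists l => g.
  exact/negPn/negP.
have /countable_injP[f injf] := countG.
have {}injf : injective f by move=> x y; apply: injf; rewrite inE.
have /choice[T hT] : forall s : G, exists l : seq G, s != 1%g ->
    [/\ uniq l, size l = (4 * (f s + 5)).+1 &
      forall t t', t \in l -> t' \in l -> t != (s * t')%g].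
  (* No constraint concerns s = 1, so any list will do there. *)
  move=> s; have [s1|s1] := boolP (s != 1%g); last by exists nil.
  have [l hl] := exists_disjoint_translate (4 * (f s + 5)).+1 inf s1.
  by exists l.
by exists T; apply: (distinct_windows_neq0 injf) => s /hT[].
Qed.
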